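(* Let $\overline{w},\overline{v}\ge0$. Consider the $\mathcal{L}_1$-optimal control problem with worst-case switching $$(\mathrm{P})\qquad \inf\ \max_{\sigma\in\mathcal{L}}\ \max_{\|\mathbf{w}^{\sigma}\|_\infty\le\overline{w},\ \|\mathbf{v}^{\sigma}\|_\infty\le\overline{v}}\|\mathbf{x}\|_\infty,$$ where the infimum is over all families of controller matrices $\{\mathbf{K}^{\sigma}\}_{\sigma\in\mathcal{L}}$ satisfying the prefix constraint [$\sigma_{0:t}=\sigma'_{0:t}\Rightarrow\mathbf{K}^{\sigma}(:t)=\mathbf{K}^{\sigma'}(:t)$ for all $\sigma,\sigma'\in\mathcal{L}$ and all $t\in\{0,\dots,T\}$], and, for each $\sigma$, $\mathbf{x}$ is the closed-loop state trajectory under $\mathbf{u}=\mathbf{K}^{\sigma}\mathbf{y}$. Consider also $$(\mathrm{P}_\Phi)\qquad \inf_{\{\mathbf{\Phi}^{\sigma}\}_{\sigma\in\mathcal{L}}}\ \max_{\sigma\in\mathcal{L}}\left\|\begin{bmatrix}\mathbf{\Phi}^{\sigma}_{xx}&\mathbf{\Phi}^{\sigma}_{xy}\end{bmatrix}\begin{bmatrix}\overline{w}I_{n(T+1)}&\mathbf{0}\\ \mathbf{0}&\overline{v}I_{m(T+1)}\end{bmatrix}\right\|_\infty,$$ where the infimum is over families $\mathbf{\Phi}^{\sigma}=\begin{bmatrix}\mathbf{\Phi}^{\sigma}_{xx}&\mathbf{\Phi}^{\sigma}_{xy}\\ \mathbf{\Phi}^{\sigma}_{ux}&\mathbf{\Phi}^{\sigma}_{uy}\end{bmatrix}$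 with block lower triangular blocks satisfying, for each $\sigma\in\mathcal{L}$, $$\begin{bmatrix}I-\mathcal{Z}\mathbf{A}^{\sigma}&-\mathcal{Z}\mathbf{B}^{\sigma}\end{bmatrix}\mathbf{\Phi}^{\sigma}=\begin{bmatrix}I&\mathbf{0}\end{bmatrix},\qquad \mathbf{\Phi}^{\sigma}\begin{bmatrix}I-\mathcal{Z}\mathbf{A}^{\sigma}\\-\mathbf{C}^{\sigma}\end{bmatrix}=\begin{bmatrix}I\\ \mathbf{0}\end{bmatrix},$$ and, for all $\sigma,\sigma'\in\mathcal{L}$ and $t\in\{0,\dots,T\}$ with $\sigma_{0:t}=\sigma'_{0:t}$, $\mathbf{\Phi}^{\sigma}_{ab}(:t)=\mathbf{\Phi}^{\sigma'}_{ab}(:t)$ for each $ab\in\{xx,xy,ux,uy\}$. Then (P) reduces to $(\mathrm{P}_\Phi)$: the two problems have the same optimal value, and if $\{\mathbf{\Phi}^{\sigma}\}_{\sigma\in\mathcal{L}}$ is optimal for $(\mathrm{P}_\Phi)$ then $\mathbf{K}^{\sigma}=\mathbf{\Phi}^{\sigma}_{uy}-\mathbf{\Phi}^{\sigma}_{ux}(\mathbf{\Phi}^{\sigma}_{xx})^{-1}\mathbf{\Phi}^{\sigma}_{xy}$, $\sigma\in\mathcal{L}$, is optimal for (P). Moreover, $(\mathrm{P}_\Phi)$ is a convex program in $\{\mathbf{\Phi}^{\sigma}\}_{\sigma\in\mathcal{L}}$ (convex objective, affine constraints) that can be written as a linear program (with auxiliary variables).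
   Context: Fix a horizon $T\ge 0$, dimensions $n,p,m$, and a number of modes $M$. For each mode $i\in\{1,\dots,M\}$ and time $t\in\{0,\dots,T\}$ there are real matrices $A^i_t\in\mathbb{R}^{n\times n}$, $B^i_t\in\mathbb{R}^{n\times p}$, $C^i_t\in\mathbb{R}^{m\times n}$. A switching signal is a function $\sigma:\{0,\dots,T\}\to\{1,\dots,M\}$, written $t\mapsto\sigma_t$, with prefix $\sigma_{0:t}=(\sigma_0,\dots,\sigma_t)$. The language $\mathcal{L}$ is a given nonempty set of switching signals (hence finite). The switched system is $x_{t+1}=A_t^{\sigma_t}x_t+B_t^{\sigma_t}u_t+w_t^{\sigma_t}$, $y_t=C_t^{\sigma_t}x_t+v_t^{\sigma_t}$. For a switching signal $\sigma$ define $\mathbf{A}^{\sigma}=\mathrm{blkdiag}\{A_0^{\sigma_0},\dots,A_{T-1}^{\sigma_{T-1}},\mathbf{0}\}$, $\mathbf{B}^{\sigma}=\mathrm{blkdiag}\{B_0^{\sigma_0},\dots,B_{T-1}^{\sigma_{T-1}},\mathbf{0}\}$, $\mathbf{C}^{\sigma}=\mathrm{blkdiag}\{C_0^{\sigma_0},\dots,C_T^{\sigma_T}\}$ (trailing zero blocks of sizes $n\times n$, $n\times p$). $\mathcal{Z}\in\mathbb{R}^{n(T+1)\times n(T+1)}$ is the block downshift operator: $T$ copies of $I_n$ on the first block subdiagonal and zeros elsewhere. Stack $\mathbf{x}=(x_0,\dots,x_T)$, $\mathbf{u}=(u_0,\dots,u_T)$, $\mathbf{y}=(y_0,\dots,y_T)$,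 $\mathbf{w}^{\sigma}=(x_0^{\sigma_0},w_0^{\sigma_0},\dots,w_{T-1}^{\sigma_{T-1}})$ (the first block is the initial state), $\mathbf{v}^{\sigma}=(v_0^{\sigma_0},\dots,v_T^{\sigma_T})$ as column vectors. The dynamics are then $\mathbf{x}=\mathcal{Z}(\mathbf{A}^{\sigma}\mathbf{x}+\mathbf{B}^{\sigma}\mathbf{u})+\mathbf{w}^{\sigma}$, $\mathbf{y}=\mathbf{C}^{\sigma}\mathbf{x}+\mathbf{v}^{\sigma}$. The noises are non-deterministic and bounded: $\mathbf{w}^{\sigma}\in\mathbb{R}^{n(T+1)}$, $\mathbf{v}^{\sigma}\in\mathbb{R}^{m(T+1)}$ range over all vectors with $\|\mathbf{w}^{\sigma}\|_\infty\le\overline{w}$, $\|\mathbf{v}^{\sigma}\|_\infty\le\overline{v}$. A controller matrix $\mathbf{K}^{\sigma}$ is block lower triangular with $(T+1)\times(T+1)$ blocks $K^{\sigma}_{(t,\tau)}\in\mathbb{R}^{p\times m}$, and $\mathbf{u}=\mathbf{K}^{\sigma}\mathbf{y}$. The prefix constraint encodes that the controller gains at time $t$ depend only on the prefix $\sigma_{0:t}$, i.e. mode-prefix-based controllers $u_t=\sum_{\tau\le t}K^{\sigma_{0:t}}_{(t,\tau)}y_\tau$. The blocks of $\mathbf{\Phi}^{\sigma}_{xx},\mathbf{\Phi}^{\sigma}_{xy},\mathbf{\Phi}^{\sigma}_{ux},\mathbf{\Phi}^{\sigma}_{uy}$ (each with $(T+1)\times(T+1)$ blocks) have sizes $n\times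 n$, $n\times m$, $p\times n$, $p\times m$. For a block lower triangular matrix $\mathbf{M}$ with block indices starting at $0$, $\mathbf{M}(:t)$ denotes its first $t+1$ block rows and block columns. For vectors $\|\cdot\|_\infty$ is the maximum absolute entry; for matrices $\|\cdot\|_\infty$ is the induced operator norm (maximum absolute row sum). *)

(* Defs.v *)
From HB Require Import structures.
From mathcomp Require Import all_boot all_order all_algebra.
From mathcomp Require Import all_classical all_reals all_analysis.

Set Implicit Arguments.
Unset Strict Implicit.
Unset Printing Implicit Defensive.

Import Order.TTheory GRing.Theory Num.Theory.
Import numFieldNormedType.Exports.

Local Open Scope classical_set_scope.
Local Open Scope ring_scope.

(* Length of a stack of T + 1 vectors of length k, i.e. k (T + 1), in the form
   expected by the block matrix operations of the matrix library. *)
Notation stack T k := (\sum_(t < T.+1) k)%N.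

Notation signal T M := {ffun 'I_T.+1 -> 'I_M}.

(* The infinity norm of a vector is the norm of the normed module 'cV[R]_b. *)
Definition opnorm (R : realType) (a b : nat) (X : 'M[R]_(a, b)) : R :=
  sup [set `|X *m z| | z in [set z : 'cV[R]_b | `|z| <= 1]].

Lemma opnormE (R : realType) (a b : nat) (X : 'M[R]_(a, b)) :
  opnorm X = \big[Num.max/0]_(i < a) \sum_(j < b) `|X i j|.
Proof.
have norm_cV k (z : 'cV[R]_k) i : `|z i 0| <= `|z|.
  rewrite [leRHS]/Num.Def.normr/= mx_normrE.
  exact: (le_bigmax _ (fun ij => `|z ij.1 ij.2|) (i, 0)).
have norm_cV_le k (z : 'cV[R]_k) (r : R) :
    0 <= r -> (forall i, `|z i 0| <= r) -> `|z| <= r.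
  move=> r0 zr; rewrite [leLHS]/Num.Def.normr/= mx_normrE.
  by apply: bigmax_le => // -[i j] _ /=; rewrite ord1.
rewrite /opnorm; set S := (X in sup X); set r := RHS.
have r0 : 0 <= r by rewrite /r bigmax_idl le_max lexx.
have Sr : ubound S r.
  move=> _ [z /= z1 <-]; apply: norm_cV_le => // i; rewrite mxE.
  apply: le_trans (ler_norm_sum _ _ _) _.
  apply: le_trans (le_bigmax _ (fun i => \sum_(j < b) `|X i j|) i).
  apply: ler_sum => j _; rewrite normrM ler_piMr//.
  exact: le_trans (norm_cV _ z j) z1.
have S0 : S !=set0 by exists `|X *m (0 : 'cV_b)|, 0 => //=; rewrite normr0.
apply/eqP; rewrite eq_le; apply/andP; split; first exact: ge_sup.
have Sge s : S s -> s <= sup S by move=> Ss; apply: ub_le_sup => //; exists r.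
apply: bigmax_le => [|i _].
  by apply: le_trans (Sge `|X *m (0 : 'cV_b)| _); [|exists 0 => //=; rewrite normr0].
pose z : 'cV[R]_b := \col_j Num.sg (X i j).
have z1 : `|z| <= 1.
  by apply: norm_cV_le => // j; rewrite mxE normr_sg; case: (_ != 0).
apply: le_trans (Sge `|X *m z| _); last by exists z.
apply: le_trans (norm_cV _ (X *m z) i); rewrite mxE.
apply: le_trans (ler_norm _); apply: ler_sum => j _.
by rewrite mxE mulrC -normrEsg.
Qed.

Section BlockMatrices.
Context {R : realType} {T : nat}.

Definition blk (a b : nat) (X : 'M[R]_(stack T a, stack T b))
    (i j : 'I_T.+1) : 'M[R]_(a, b) :=
  @submxblock R T.+1 T.+1 (fun=> a) (fun=> b) X i j.

(* The library's \mxdiag only accepts square diagonal blocks. *)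
Definition blkdiag (a b : nat) (D : 'I_T.+1 -> 'M[R]_(a, b)) :
    'M[R]_(stack T a, stack T b) :=
  \mxblock_(i < T.+1, j < T.+1) (if i == j then D i else 0).

Definition downshift (n : nat) : 'M[R]_(stack T n) :=
  \mxblock_(i < T.+1, j < T.+1)
    (if i == j.+1 :> nat then 1%:M else 0 : 'M[R]_n).

Definition blk_lower_trig (a b : nat) (X : 'M[R]_(stack T a, stack T b)) :=
  forall i j : 'I_T.+1, (i < j)%N -> blk X i j = 0.

(* X(:t), the first t + 1 block rows and block columns of X *)
Definition blk_lead (a b : nat) (t : 'I_T.+1)
    (X : 'M[R]_(stack T a, stack T b)) : 'M[R]_(stack t a, stack t b) :=
  \mxblock_(i < t.+1, j < t.+1)
    blk X (widen_ord (ltn_ord t) i) (widen_ord (ltn_ord t) j).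

End BlockMatrices.

Section Programs.
Context {R : realType}.

Definition optimal_value (E : Type) (S : set E) (f : E -> \bar R) : \bar R :=
  ereal_inf [set f z | z in S].

Definition optimal (E : Type) (S : set E) (f : E -> \bar R) (z : E) :=
  S z /\ forall z', S z' -> (f z <= f z')%E.

Definition affine_constraints (E : lmodType R) (S : set E) :=
  exists (k : nat) (F : {linear E -> 'cV[R]_k}) (b : 'cV[R]_k),
    S = [set z | F z = b].

Record linear_program (E : lmodType R) := LinearProgram {
  lp_objective : {linear E -> R^o};
  lp_size : nat;
  lp_lhs : {linear E -> 'cV[R]_lp_size};
  lp_rhs : 'cV[R]_lp_size }.

Definition lp_feasible (E : lmodType R) (P : linear_program E) : set E :=
  [set z | forall i, lp_lhs P z i 0 <= lp_rhs P i 0].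

(* P, in the variable z and the auxiliary variables s, is the program of
   minimizing f over S: minimizing P over s alone gives, for each z, the value
   f z (attained) if z is in S, and is infeasible otherwise. *)
Definition lp_reformulation (E : lmodType R) (S : set E) (f : E -> R)
    (a : nat) (P : linear_program (E * 'cV[R]_a)%type) :=
  (forall z s, lp_feasible P (z, s) -> S z /\ f z <= lp_objective P (z, s)) /\
  (forall z, S z ->
     exists s, lp_feasible P (z, s) /\ lp_objective P (z, s) = f z).

End Programs.

Section SwitchedSystem.
Context {R : realType} {T n p m M : nat}.
Variable A : 'I_M -> 'I_T.+1 -> 'M[R]_n.
Variable B : 'I_M -> 'I_T.+1 -> 'M[R]_(n, p).
Variable C : 'I_M -> 'I_T.+1 -> 'M[R]_(m, n).
Variable L : {set signal T M}.
Variables wbar vbar : R.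

Local Notation Z := (downshift n).
Local Notation idx := {sigma : signal T M | sigma \in L}.

Definition bigA (sigma : signal T M) : 'M[R]_(stack T n) :=
  blkdiag (fun t => if (t < T)%N then A (sigma t) t else 0).

Definition bigB (sigma : signal T M) : 'M[R]_(stack T n, stack T p) :=
  blkdiag (fun t => if (t < T)%N then B (sigma t) t else 0).

Definition bigC (sigma : signal T M) : 'M[R]_(stack T m, stack T n) :=
  blkdiag (fun t => C (sigma t) t).

Definition same_prefix (t : 'I_T.+1) (sigma sigma' : signal T M) :=
  forall s : 'I_T.+1, (s <= t)%N -> sigma s = sigma' s.

Definition prefix_constraint (a b : nat)
    (X : idx -> 'M[R]_(stack T a, stack T b)) :=
  forall (i j : idx) (t : 'I_T.+1), same_prefix t (val i) (val j) ->
    blk_lead t (X i) = blk_lead t (X j).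

Definition controller : Type := {ffun idx -> 'M[R]_(stack T p, stack T m)}.

Definition admissible : set controller :=
  [set K | (forall i, blk_lower_trig (K i)) /\ prefix_constraint K].

Definition closed_loop (sigma : signal T M)
    (K : 'M[R]_(stack T p, stack T m))
    (w : 'cV[R]_(stack T n)) (v : 'cV[R]_(stack T m))
    (x : 'cV[R]_(stack T n)) (u : 'cV[R]_(stack T p))
    (y : 'cV[R]_(stack T m)) :=
  [/\ x = Z *m (bigA sigma *m x + bigB sigma *m u) + w,
      y = bigC sigma *m x + v
    & u = K *m y].

Definition state_norms (sigma : signal T M)
    (K : 'M[R]_(stack T p, stack T m)) : set R :=
  [set r | exists w v x u y, [/\ `|w| <= wbar, `|v| <= vbar,
             closed_loop sigma K w v x u y & r = `|x|]].

Definition cost_P (K : controller) : \bar R :=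
  \big[maxe/-oo%E]_(i : idx)
    ereal_sup [set r%:E | r in state_norms (val i) (K i)].

Definition response : Type :=
  'M[R]_(stack T n + stack T p, stack T n + stack T m).

Definition Phi_xx (Phi : response) : 'M[R]_(stack T n) := ulsubmx Phi.
Definition Phi_xy (Phi : response) : 'M[R]_(stack T n, stack T m) :=
  ursubmx Phi.
Definition Phi_ux (Phi : response) : 'M[R]_(stack T p, stack T n) :=
  dlsubmx Phi.
Definition Phi_uy (Phi : response) : 'M[R]_(stack T p, stack T m) :=
  drsubmx Phi.

Definition responses := {ffun idx -> response}.

Definition achievable (sigma : signal T M) (Phi : response) :=
  row_mx (1%:M - Z *m bigA sigma) (- (Z *m bigB sigma)) *m Phi
    = row_mx 1%:M 0 /\
  Phi *m col_mx (1%:M - Z *m bigA sigma) (- bigC sigma) = col_mx 1%:M 0.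

Definition feasible_Phi : set responses :=
  [set Phi | [/\ forall i, [/\ blk_lower_trig (Phi_xx (Phi i)),
                               blk_lower_trig (Phi_xy (Phi i)),
                               blk_lower_trig (Phi_ux (Phi i))
                             & blk_lower_trig (Phi_uy (Phi i))],
                 forall i, achievable (val i) (Phi i)
               & [/\ prefix_constraint (fun i => Phi_xx (Phi i)),
                     prefix_constraint (fun i => Phi_xy (Phi i)),
                     prefix_constraint (fun i => Phi_ux (Phi i))
                   & prefix_constraint (fun i => Phi_uy (Phi i))]]].

(* The norms are nonnegative, so 0 is a neutral start for the maximum. *)
Definition cost_Phi (Phi : responses) : R :=
  \big[Num.max/0]_(i : idx)
    opnorm (row_mx (Phi_xx (Phi i)) (Phi_xy (Phi i)) *m
            block_mx (wbar%:M : 'M[R]_(stack T n)) 0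
                     0 (vbar%:M : 'M[R]_(stack T m))).

Definition controller_of (Phi : responses) : controller :=
  [ffun i => Phi_uy (Phi i) -
             Phi_ux (Phi i) *m invmx (Phi_xx (Phi i)) *m Phi_xy (Phi i)].

End SwitchedSystem.

Arguments admissible R {T} p m {M} L.
Arguments cost_P {R T n p m M} A B C L wbar vbar K.
Arguments responses R {T} n p m {M} L.
Arguments feasible_Phi {R T n p m M} A B C L.
Arguments cost_Phi {R T n p m M} L wbar vbar Phi.

(* Main.v *)
Require Import Defs.
From HB Require Import structures.
From mathcomp Require Import all_boot all_order all_algebra.
From mathcomp Require Import all_classical all_reals all_analysis.
From mathcomp Require Import ring.

Set Implicit Arguments.
Unset Strict Implicit.
Unset Printing Implicit Defensive.

Import Order.TTheory GRing.Theory Num.Theory.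
Import numFieldNormedType.Exports.

Local Open Scope classical_set_scope.
Local Open Scope ring_scope.

(** Write N = Z (A + B K C) for the loop matrix of a controller K. It is
    strictly block lower triangular, because Z is and A, B, C, K are block
    lower triangular, so 1 - N is invertible and the closed loop has the
    unique state trajectory x = Y w + Y Z B K v with Y = (1 - N)^-1. The
    set of values of the state norm is therefore the set of the norms of
    X z, for z in the unit ball, where X is the matrix [Y, Y Z B K] weighted
    by the two noise bounds [state_normsE], and the worst case is the
    induced norm of X, which is the summand of the cost of (P_Phi).

    Hence a controller and a response have the same cost as soon as the
    first block row of the response is [Y, Y Z B K] (predicate [realizes],
    lemma [cost_P_Phi]). A controller K defines such a response, with
    lower blocks K C Y and K + K C Y Z B K [achievable_of_controller];
    conversely the affine constraints force the controller Phi_uy - Phi_ux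
    Phi_xx^-1 Phi_xy to have the top blocks of Phi as its state responses
    [controller_of_achievable]. Both maps preserve block triangularity and
    the prefix constraint, because the leading blocks of sums, of products
    of block lower triangular matrices and of the inverse of 1 - N depend
    only on the leading blocks of the operands [blk_leadM, blk_lead_inv].
    So the two problems have the same set of achieved costs, and optimal
    responses are sent to optimal controllers.

    For the last two claims, every constraint is a finite conjunction of
    linear equations, and the cost is a maximum over rows of sums of
    absolute values of linear forms. Such a maximum is convex, and the
    usual linear program with one variable bounding each absolute value
    and one bounding each row sum computes it. *)

(** * Block triangular matrices *)

Section BlockCalculus.
Context {R : realType} {T : nat}.
Local Notation bmat a b := 'M[R]_(stack T a, stack T b).
Implicit Types (i j k t : 'I_T.+1) (D : rel 'I_T.+1).

Lemma blkP a b (X Y : bmat a b) : (forall i j, blk X i j = blk Y i j) -> X = Y.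
Proof. by move=> XY; apply/mxblockP. Qed.

Lemma blkD a b (X Y : bmat a b) i j : blk (X + Y) i j = blk X i j + blk Y i j.
Proof. exact: submxblockD. Qed.

Lemma blkN a b (X : bmat a b) i j : blk (- X) i j = - blk X i j.
Proof. exact: submxblockN. Qed.

Lemma blk0 a b i j : blk (0 : bmat a b) i j = 0.
Proof. exact: submxblock0. Qed.

Lemma blkZ a b c (X : bmat a b) i j : blk (c *: X) i j = c *: blk X i j.
Proof. by apply/matrixP=> r s; rewrite !mxE. Qed.

Lemma blkM a b c (X : bmat a b) (Y : bmat b c) i j :
  blk (X *m Y) i j = \sum_k blk X i k *m blk Y k j.
Proof.
rewrite -[in LHS](submxblockK X) -[in LHS](submxblockK Y) mul_mxblock.
exact: mxblockK.
Qed.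

Lemma blk_1 a i j : i != j -> blk (1%:M : bmat a a) i j = 0.
Proof.
move=> ij; apply/matrixP=> r s; rewrite !mxE -val_eqE tagnat.eq_Rank.
by rewrite (negPf ij).
Qed.

(** Both block triangularity and equality of leading parts are equalities on a
    set D of block positions: the positions above the diagonal, where the matrix
    is compared with 0, and those of the leading part.  What makes them stable
    under products is that D contains, with a position, all the positions above
    it in the same column.  The left factor of a product then has to be
    compared on the hull of D, the lower triangular positions of its block
    rows that meet D. *)
Definition eq_on a b D (X Y : bmat a b) :=
  forall i j, D i j -> blk X i j = blk Y i j.

Definition row_down D := forall i k j, (k <= i)%N -> D i j -> D k j.

Definition eq_hull a b D (X Y : bmat a b) :=
  forall i j k, D i j -> (k <= i)%N -> blk X i k = blk Y i k.

Definition blk_strict a b (X : bmat a b) :=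
  forall i j, (i <= j)%N -> blk X i j = 0.

Lemma strict_lower a b (X : bmat a b) : blk_strict X -> blk_lower_trig X.
Proof. by move=> X0 i j /ltnW; exact: X0. Qed.

(** Only the blocks k <= i of the left factor contribute to the block row i of
    the product, and D contains (k, j) whenever it contains (i, j). *)
Lemma eq_on_mul a b c D (X X' : bmat a b) (Y Y' : bmat b c) :
  row_down D -> blk_lower_trig X -> blk_lower_trig X' ->
  eq_hull D X X' -> eq_on D Y Y' -> eq_on D (X *m Y) (X' *m Y').
Proof.
move=> Dd lX lX' XX' YY' i j Dij; rewrite !blkM; apply: eq_bigr => k _.
case: (leqP k i) => [ki|ik]; last by rewrite lX// lX'// !mul0mx.
by rewrite (XX' i j)// (YY' k j)//; apply: Dd Dij.
Qed.

(** By strong induction on the block row: row i of N Y involves only the rows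
    of Y above i.  This is forward substitution, and it carries every property
    of (1 - N)^-1. *)
Lemma eq_on_fix a b D (N N' : bmat a a) (E E' Y Y' : bmat a b) :
  row_down D -> blk_strict N -> blk_strict N' ->
  eq_hull D N N' -> eq_on D E E' ->
  Y = E + N *m Y -> Y' = E' + N' *m Y' -> eq_on D Y Y'.
Proof.
move=> Dd sN sN' NN' EE' eY eY' i.
have [r] := ubnP (i : nat); elim: r i => // r IH i ir j Dij.
rewrite eY eY' !blkD EE'//; congr (_ + _); rewrite !blkM.
apply: eq_bigr => k _; case: (leqP i k) => [ik|ki].
  by rewrite sN// sN'// !mul0mx.
rewrite (NN' i j k Dij (ltnW ki)) IH//; first exact: leq_trans ki _.
exact: Dd (ltnW ki) Dij.
Qed.

Let above : rel 'I_T.+1 := fun i j => (i < j)%N.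

Let above_down : row_down above.
Proof. by move=> i k j ki; apply: leq_ltn_trans. Qed.

Let lowerP a b (X : bmat a b) : blk_lower_trig X <-> eq_on above X 0.
Proof.
split=> lX i j ij; first by rewrite blk0; apply: lX.
by rewrite lX// blk0.
Qed.

Lemma lower1 a : blk_lower_trig (1%:M : bmat a a).
Proof. by move=> i j ij; rewrite blk_1// neq_ltn ij. Qed.

Lemma lowerD a b (X Y : bmat a b) :
  blk_lower_trig X -> blk_lower_trig Y -> blk_lower_trig (X + Y).
Proof. by move=> lX lY i j ij; rewrite blkD lX// lY// addr0. Qed.

Lemma lowerN a b (X : bmat a b) : blk_lower_trig X -> blk_lower_trig (- X).
Proof. by move=> lX i j ij; rewrite blkN lX// oppr0. Qed.

Lemma lowerM a b c (X : bmat a b) (Y : bmat b c) :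
  blk_lower_trig X -> blk_lower_trig Y -> blk_lower_trig (X *m Y).
Proof.
move=> lX /lowerP lY; apply/lowerP; rewrite -(mulmx0 _ X).
exact: eq_on_mul.
Qed.

Lemma lower_blkdiag a b (X : 'I_T.+1 -> 'M[R]_(a, b)) :
  blk_lower_trig (blkdiag X).
Proof.
move=> i j ij; rewrite /blk /blkdiag mxblockK.
by case: eqP ij => // ->; rewrite ltnn.
Qed.

Lemma downshift_strict a : blk_strict (downshift a : 'M[R]_(stack T a)).
Proof.
move=> i j ij; rewrite /blk /downshift mxblockK.
by case: eqP ij => // ->; rewrite ltnn.
Qed.

Lemma strictMl a b c (X : bmat a b) (Y : bmat b c) :
  blk_strict X -> blk_lower_trig Y -> blk_strict (X *m Y).
Proof.
move=> sX lY i j ij; rewrite blkM big1// => k _.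
case: (leqP i k) => [ik|ki]; first by rewrite sX// mul0mx.
by rewrite lY ?mulmx0//; apply: leq_trans ij.
Qed.

Lemma strictD a b (X Y : bmat a b) :
  blk_strict X -> blk_strict Y -> blk_strict (X + Y).
Proof. by move=> sX sY i j ij; rewrite blkD sX// sY// addr0. Qed.

Lemma strictN a b (X : bmat a b) : blk_strict X -> blk_strict (- X).
Proof. by move=> sX i j ij; rewrite blkN sX// oppr0. Qed.

(** A matrix Y with (1 - N) Y = 0 solves the same fixed point equation as 0. *)
Lemma strict_unit a (N : bmat a a) : blk_strict N -> 1%:M - N \in unitmx.
Proof.
move=> sN; rewrite -unitmx_tr -row_free_unit -kermx_eq0.
set Y := kermx _; apply/eqP.
have : eq_on (fun _ _ => true) Y^T (0 : bmat a a).
  apply: (@eq_on_fix _ _ _ N N 0 0) => //; last by rewrite mulmx0 addr0.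
  have : ((1%:M - N) *m Y^T)^T = 0 by rewrite trmx_mul trmxK mulmx_ker.
  rewrite add0r => /(congr1 trmx); rewrite trmxK trmx0 mulmxBl mul1mx.
  by move/eqP; rewrite subr_eq0 => /eqP.
move=> Y0; apply: trmx_inj; rewrite trmx0; apply: blkP => i j; exact: Y0.
Qed.

Lemma invmx_fix a (N : bmat a a) : blk_strict N ->
  invmx (1%:M - N) = 1%:M + N *m invmx (1%:M - N).
Proof.
move=> /strict_unit uN; apply/eqP; rewrite -subr_eq; apply/eqP.
by rewrite -{1}[invmx _]mul1mx -mulmxBl mulmxV.
Qed.

Lemma lower_inv a (N : bmat a a) :
  blk_strict N -> blk_lower_trig (invmx (1%:M - N)).
Proof.
move=> sN; apply/lowerP.
apply: (@eq_on_fix _ _ _ N N 1%:M 0) => //.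
- exact/lowerP/lower1.
- exact: invmx_fix.
- by rewrite mulmx0 addr0.
Qed.

Section Lead.
Variable t : 'I_T.+1.

Let lead : rel 'I_T.+1 := fun i j => (i <= t)%N && (j <= t)%N.

Let lead_down : row_down lead.
Proof.
by move=> i k j ki /andP[it jt]; rewrite /lead jt andbT; exact: leq_trans it.
Qed.

Lemma blk_leadP a b (X Y : bmat a b) :
  blk_lead t X = blk_lead t Y <->
  forall i j, (i <= t)%N -> (j <= t)%N -> blk X i j = blk Y i j.
Proof.
rewrite -eq_mxblockP; split=> XY i j; last first.
  by apply: XY => /=; rewrite -ltnS.
have widenE (k : 'I_T.+1) (kt : (k < t.+1)%N) :
    widen_ord (ltn_ord t) (Ordinal kt) = k by exact: val_inj.
rewrite -(ltnS i) -(ltnS j) => it jt.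
by have := XY (Ordinal it) (Ordinal jt); rewrite !widenE.
Qed.

Let leadP a b (X Y : bmat a b) :
  blk_lead t X = blk_lead t Y <-> eq_on lead X Y.
Proof.
rewrite blk_leadP; split=> XY i j; first by case/andP; exact: XY.
by move=> it jt; apply: XY; rewrite /lead it.
Qed.

Let lead_hull a b (X Y : bmat a b) :
  blk_lead t X = blk_lead t Y -> eq_hull lead X Y.
Proof.
move=> /blk_leadP XY i j k /andP[it _] ki; apply: XY => //.
exact: leq_trans it.
Qed.

Lemma blk_leadD a b (X X' Y Y' : bmat a b) :
  blk_lead t X = blk_lead t X' -> blk_lead t Y = blk_lead t Y' ->
  blk_lead t (X + Y) = blk_lead t (X' + Y').
Proof. by rewrite !leadP => XX' YY' i j Dij; rewrite !blkD XX'// YY'. Qed.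

Lemma blk_leadN a b (X X' : bmat a b) :
  blk_lead t X = blk_lead t X' -> blk_lead t (- X) = blk_lead t (- X').
Proof. by rewrite !leadP => XX' i j Dij; rewrite !blkN XX'. Qed.

(** A block lower triangular left factor is what keeps the blocks beyond t of
    the operands out of the leading part of the product. *)
Lemma blk_leadM a b c (X X' : bmat a b) (Y Y' : bmat b c) :
  blk_lower_trig X -> blk_lower_trig X' ->
  blk_lead t X = blk_lead t X' -> blk_lead t Y = blk_lead t Y' ->
  blk_lead t (X *m Y) = blk_lead t (X' *m Y').
Proof.
move=> lX lX' /lead_hull XX' /leadP YY'; apply/leadP; exact: eq_on_mul.
Qed.

Lemma blk_lead_inv a (N N' : bmat a a) : blk_strict N -> blk_strict N' ->
  blk_lead t N = blk_lead t N' ->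
  blk_lead t (invmx (1%:M - N)) = blk_lead t (invmx (1%:M - N')).
Proof.
move=> sN sN' /lead_hull NN'; apply/leadP.
apply: (@eq_on_fix _ _ _ N N' 1%:M 1%:M) => //; exact: invmx_fix.
Qed.

Lemma blk_lead_blkdiag a b (X Y : 'I_T.+1 -> 'M[R]_(a, b)) :
  (forall i, (i <= t)%N -> X i = Y i) ->
  blk_lead t (blkdiag X) = blk_lead t (blkdiag Y).
Proof.
move=> XY; apply/leadP => i j /andP[it _]; rewrite /blk /blkdiag !mxblockK.
by case: eqP => // _; rewrite XY.
Qed.

End Lead.

End BlockCalculus.

(** * Systems of linear constraints *)

Section LinearSystems.
Context {R : realType}.
Implicit Types (E : lmodType R) (r : rel R).

(** The relation r is equality for affine constraints and <= for the
    constraints of a linear program; closure under finite conjunctions is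
    the same proof for both. *)
Definition linear_system E r (S : set E) :=
  exists (k : nat) (F : {linear E -> 'cV[R]_k}) (b : 'cV[R]_k),
    S = [set z | forall i, r (F z i 0) (b i 0)].

Lemma linear_system1 E r (f : E -> R) (c : R) :
  linear (f : E -> R^o) -> linear_system r [set z | r (f z) c].
Proof.
move=> lf; pose F (z : E) : 'cV[R]_1 := \col_(i < 1) f z.
have lF : linear F by move=> a x y; apply/colP => i; rewrite !mxE; exact: lf.
pose F' : {linear E -> 'cV[R]_1} :=
  HB.pack F (GRing.isLinear.Build _ _ _ _ F lF).
exists 1%N, F', (\col_(i < 1) c); apply/seteqP.
by split=> z /= => [rz i|/(_ 0)]; rewrite !mxE.
Qed.

Lemma linear_systemT E r : linear_system r [set: E].
Proof.
pose F (z : E) : 'cV[R]_0 := 0.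
have lF : linear F by move=> a x y; rewrite scaler0 addr0.
pose F' : {linear E -> 'cV[R]_0} :=
  HB.pack F (GRing.isLinear.Build _ _ _ _ F lF).
by exists 0%N, F', 0; apply/seteqP; split=> z //= _ [].
Qed.

Lemma linear_systemI E r (S S' : set E) :
  linear_system r S -> linear_system r S' -> linear_system r (S `&` S').
Proof.
move=> [k [F [b ->]]] [k' [F' [b' ->]]].
pose G (z : E) : 'cV[R]_(k + k') := col_mx (F z) (F' z).
have lG : linear G.
  by move=> a x y; rewrite /G !linearP /= scale_col_mx add_col_mx.
pose G' : {linear E -> 'cV[R]_(k + k')} :=
  HB.pack G (GRing.isLinear.Build _ _ _ _ G lG).
exists (k + k')%N, G', (col_mx b b'); apply/seteqP; split=> z /=.
  move=> [zF zF'] i; rewrite /G; case: (splitP i) => j ij.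
    by have -> : i = lshift k' j by [exact: val_inj]; rewrite !col_mxEu.
  by have -> : i = rshift k j by [exact: val_inj]; rewrite !col_mxEd.
move=> zG; split=> i; first by have := zG (lshift k' i); rewrite !col_mxEu.
by have := zG (rshift k i); rewrite !col_mxEd.
Qed.

Lemma linear_system_forall E r (I : finType) (S : I -> set E) :
  (forall i, linear_system r (S i)) ->
  linear_system r [set z | forall i, S i z].
Proof.
move=> lS; suff aux (s : seq I) :
    linear_system r [set z | forall i, i \in s -> S i z].
  rewrite (_ : [set z | _] = [set z | forall i, i \in enum I -> S i z]) //.
  by apply/seteqP; split=> z /= Sz i //; apply: Sz; rewrite mem_enum.
elim: s => [|i s IH].
  rewrite (_ : mkset _ = setT); first exact: linear_systemT.
  by apply/seteqP; split=> z.
rewrite (_ : mkset _ = S i `&` [set z | forall i, i \in s -> S i z]).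
  exact: linear_systemI.
apply/seteqP; split=> z /= => [Sz|[Siz Sz] j].
  by split=> [|j js]; apply: Sz; rewrite in_cons ?eqxx// js orbT.
by rewrite in_cons => /predU1P[->|]//; exact: Sz.
Qed.

Lemma linear_system_imply E r (P : Prop) (S : set E) :
  linear_system r S -> linear_system r [set z | P -> S z].
Proof.
move=> lS; have [HP|HP] := pselect P.
  by rewrite (_ : mkset _ = S)//; apply/seteqP; split=> z //=; exact.
rewrite (_ : mkset _ = setT); first exact: linear_systemT.
by apply/seteqP; split=> z //= _ /HP.
Qed.

Lemma linear_system_preimage E E' r (g : E' -> E) (S : set E) :
  linear g -> linear_system r S -> linear_system r (g @^-1` S).
Proof.
move=> lg [k [F [b ->]]]; pose G (z : E') : 'cV[R]_k := F (g z).
have lG : linear G by move=> a x y; rewrite /G lg linearP.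
pose G' : {linear E' -> 'cV[R]_k} :=
  HB.pack G (GRing.isLinear.Build _ _ _ _ G lG).
by exists k, G', b.
Qed.

Definition linear_equations E (S : set E) :=
  linear_system (fun x y : R => x == y) S.

Definition linear_inequalities E (S : set E) :=
  linear_system (fun x y : R => x <= y) S.

Lemma linear_equations_mx E a b (f : E -> 'M[R]_(a, b)) (c : 'M[R]_(a, b)) :
  linear f -> linear_equations [set z | f z = c].
Proof.
move=> lf; rewrite (_ : mkset _ = [set z | forall i j, f z i j == c i j]).
  apply: linear_system_forall => i; apply: linear_system_forall => j.
  by apply: linear_system1 => u x y; rewrite lf !mxE.
apply/seteqP; split=> z /= => [-> //|zc].
by apply/matrixP => i j; apply/eqP.
Qed.

Lemma affine_linear_equations E (S : set E) :
  linear_equations S -> affine_constraints S.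
Proof.
move=> [k [F [b ->]]]; exists k, F, b; apply/seteqP; split=> z /=.
  by move=> Fz; apply/colP => i; apply/eqP.
by move=> <-.
Qed.

Lemma linear_equationsW E (S : set E) :
  linear_equations S -> linear_inequalities S.
Proof.
move=> [k [F [b ->]]].
rewrite (_ : mkset _ =
  [set z | forall i, F z i 0 <= b i 0] `&`
  [set z | forall i, - F z i 0 <= - b i 0]).
  apply: linear_systemI; apply: linear_system_forall => i;
    apply: linear_system1 => u x y; rewrite linearP !mxE //.
  by rewrite opprD scalerN.
apply/seteqP; split=> z /= => [Fz|[Fz Fz'] i].
  by split=> i; rewrite (eqP (Fz i)).
by rewrite eq_le Fz/= -lerN2 Fz'.
Qed.

End LinearSystems.

(** * Maxima of sums of absolute values of linear forms *)

Section MaxRowSum.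
Context {R : realType} {E : lmodType R} {I J : finType}.
Variable g : I -> J -> E -> R.
Hypothesis g_linear : forall i j, linear (g i j : E -> R^o).

Let f z := \big[Num.max/0]_i \sum_j `|g i j z|.

Lemma max_row_sum_convex : convex_function setT (f : E -> R).
Proof.
move=> t x y _ _.
have : forall u v : R, 0 <= u -> 0 <= v ->
    f (u *: (x : E) + v *: (y : E)) <= u * f x + v * f y; last first.
  by apply; rewrite ?subr_ge0.
move=> u v u0 v0.
have f_ge0 z : 0 <= f z by exact: bigmax_ge_id.
apply: bigmax_le => [|i _]; first by rewrite addr_ge0 ?mulr_ge0 ?f_ge0.
have gE j : g i j (u *: (x : E) + v *: (y : E)) = u * g i j x + v * g i j y.
  pose gl : {linear E -> R^o} :=
    HB.pack (g i j : E -> R^o) (GRing.isLinear.Build _ _ _ _ _ (g_linear i j)).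
  by rewrite -[g i j]/(gl : E -> R) linearD !linearZ.
have row_le z : \sum_j `|g i j z| <= f z.
  exact: (le_bigmax _ (fun i => \sum_j `|g i j z|)).
apply: le_trans (lerD (ler_wpM2l u0 (row_le x)) (ler_wpM2l v0 (row_le y))).
rewrite !mulr_sumr -big_split/=; apply: ler_sum => j _; rewrite gE.
apply: le_trans (ler_normD _ _) _.
by rewrite !normrM (ger0_norm u0) (ger0_norm v0).
Qed.

(** The auxiliary vector is (gamma, q) with one q_ij for each linear form:
    minimize gamma subject to |g_ij| <= q_ij and sum_j q_ij <= gamma.  The
    constraint 0 <= gamma matters when there are no rows, where the maximum
    is 0. *)
Lemma max_row_sum_lp (S : set E) : linear_equations S ->
  exists (a : nat) (P : linear_program (E * 'cV[R]_a)%type),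
    lp_reformulation S f P.
Proof.
move=> lS; pose a := (1 + #|{: I * J}|)%N.
pose gam (s : 'cV[R]_a) : R := s (lshift _ 0) 0.
pose q (s : 'cV[R]_a) i j : R := s (rshift 1 (enum_rank (i, j))) 0.
pose V : set (E * 'cV[R]_a)%type := [set zs |
  S zs.1 /\ - gam zs.2 <= 0 /\
  (forall i j, g i j zs.1 - q zs.2 i j <= 0) /\
  (forall i j, - g i j zs.1 - q zs.2 i j <= 0) /\
  (forall i, \sum_j q zs.2 i j - gam zs.2 <= 0)].
have [k [F [b VE]]] : linear_inequalities V.
  apply: linear_systemI; last apply: linear_systemI;
    last apply: linear_systemI; last apply: linear_systemI.
  - by apply: linear_system_preimage; [move=> u x y|exact: linear_equationsW].
  - by apply: linear_system1 => u x y; rewrite /gam /= !mxE opprD scalerN.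
  - apply: linear_system_forall => i; apply: linear_system_forall => j.
    apply: linear_system1 => u x y; rewrite /q /= !mxE g_linear /GRing.scale/=.
    ring.
  - apply: linear_system_forall => i; apply: linear_system_forall => j.
    apply: linear_system1 => u x y; rewrite /q /= !mxE g_linear /GRing.scale/=.
    ring.
  - apply: linear_system_forall => i.
    apply: linear_system1 => u x y; rewrite /q /gam /= !mxE /GRing.scale/=.
    under eq_bigr do rewrite !mxE.
    rewrite big_split/= -mulr_sumr; ring.
pose G (zs : (E * 'cV[R]_a)%type) : R^o := gam zs.2.
have lG : linear G by move=> u x y; rewrite /G /gam !mxE.
pose G' : {linear (E * 'cV[R]_a)%type -> R^o} :=
  HB.pack G (GRing.isLinear.Build _ _ _ _ G lG).
pose P := LinearProgram G' F b.
have PV : lp_feasible P = V by rewrite VE.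
exists a, P; rewrite /lp_reformulation PV.
split=> [z s [/= Sz [s0 [q1 [q2 q3]]]]|z Sz].
  split=> //; apply: bigmax_le => [|i _]; first by rewrite -oppr_le0.
  apply: (@le_trans _ _ (\sum_j q s i j)); last by rewrite -subr_le0.
  apply: ler_sum => j _; rewrite ler_norml.
  by have := q1 i j; have := q2 i j; rewrite /= !subr_le0 lerNl => -> ->.
pose s : 'cV[R]_a := col_mx (\col_(i < 1) f z)
  (\col_(l < #|{: I * J}|) `|g (enum_val l).1 (enum_val l).2 z|).
have gamE : gam s = f z by rewrite /gam col_mxEu mxE.
have qE i j : q s i j = `|g i j z|.
  by rewrite /q col_mxEd mxE enum_rankK.
exists s; split=> //; split=> //=; rewrite gamE; split.
  by rewrite oppr_le0; exact: bigmax_ge_id.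
split=> [i j|]; first by rewrite qE subr_le0 ler_norm.
split=> [i j|i]; first by rewrite qE subr_le0 -normrN ler_norm.
rewrite subr_le0; under eq_bigr do rewrite qE.
exact: (le_bigmax _ (fun i => \sum_j `|g i j z|)).
Qed.

End MaxRowSum.

(** * The induced norm and its worst-case vectors *)

Section OperatorNorm.
Context {R : realType}.

Lemma cV_norm_leP k (z : 'cV[R]_k) (r : R) : 0 <= r ->
  `|z| <= r <-> forall i, `|z i 0| <= r.
Proof.
move=> r0; rewrite [`|z|]/Num.Def.normr/= mx_normrE; split=> [zr i|zr].
  apply: le_trans zr.
  exact: (le_bigmax _ (fun ij => `|z ij.1 ij.2|) (i, 0)).
by apply: bigmax_le => // -[i j] _ /=; rewrite ord1.
Qed.

Lemma col_mx_norm_le a b (y : 'cV[R]_a) (z : 'cV[R]_b) (r : R) : 0 <= r ->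
  `|y| <= r -> `|z| <= r -> `|col_mx y z| <= r.
Proof.
move=> r0 /(cV_norm_leP _ r0) yr /(cV_norm_leP _ r0) zr.
by apply/cV_norm_leP => // i; rewrite mxE; case: splitP.
Qed.

Lemma opnorm_ge0 a b (X : 'M[R]_(a, b)) : 0 <= opnorm X.
Proof. by rewrite opnormE bigmax_ge_id. Qed.

Lemma opnorm_ge a b (X : 'M[R]_(a, b)) (z : 'cV[R]_b) :
  `|z| <= 1 -> `|X *m z| <= opnorm X.
Proof.
move=> /(cV_norm_leP _ ler01) z1; apply/(cV_norm_leP _ (opnorm_ge0 X)) => i.
rewrite opnormE mxE; apply: le_trans (ler_norm_sum _ _ _) _.
apply: le_trans (le_bigmax _ (fun i => \sum_(j < b) `|X i j|) i).
by apply: ler_sum => j _; rewrite normrM ler_piMr.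
Qed.

(** The vector of the signs of a row with the largest absolute sum. *)
Lemma opnorm_attained a b (X : 'M[R]_(a, b)) :
  exists2 z : 'cV[R]_b, `|z| <= 1 & `|X *m z| = opnorm X.
Proof.
have [i _|a0] := pickP 'I_a; last first.
  exists 0; first by rewrite normr0.
  by rewrite mulmx0 normr0 opnormE big_pred0 // => i; have := a0 i.
have [k _ Xk] : {k | k \in 'I_a & opnorm X = \sum_(j < b) `|X k j|}.
  by rewrite opnormE; apply: (eq_bigmax i) => // l _; exact: sumr_ge0.
have z1 : `|\col_j Num.sg (X k j) : 'cV[R]_b| <= 1.
  by apply/cV_norm_leP => // j; rewrite mxE normr_sg; case: (_ != 0).
exists (\col_j Num.sg (X k j)) => //; apply/eqP; rewrite eq_le opnorm_ge//=.
rewrite {1}Xk; apply: le_trans ((cV_norm_leP _ (normr_ge0 _)).1 (lexx _) k).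
rewrite mxE; apply: le_trans (ler_norm _); apply: ler_sum => j _.
by rewrite mxE mulrC -normrEsg.
Qed.

Lemma scaled_ballP k (r : R) (w : 'cV[R]_k) : 0 <= r ->
  `|w| <= r <-> exists2 z, `|z| <= 1 & w = r *: z.
Proof.
move=> r0; split=> [wr|[z z1 ->]]; last by rewrite normrZ ger0_norm// ler_piMr.
move: r0; rewrite le_eqVlt => /predU1P[r0|r0].
  exists 0; first by rewrite normr0.
  by rewrite scaler0; apply/eqP; rewrite -normr_le0 r0.
exists (r^-1 *: w); last by rewrite scalerA divff ?scale1r// gt_eqF.
by rewrite normrZ gtr0_norm ?invr_gt0// mulrC ler_pdivrMr ?mul1r.
Qed.

End OperatorNorm.

(** * Controllers and achievable responses *)

Section ResponseAlgebra.
Context {F : comUnitRingType} {n p m : nat}.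
Variables (a : 'M[F]_n) (b : 'M[F]_(n, p)) (c : 'M[F]_(m, n)).

(** Here a, b and c stand for Z A, Z B and C.  The identities follow from
    (1 - a) Y = 1 + b K c Y and Y (1 - a) = 1 + Y b K c. *)
Lemma achievable_of_controller (K : 'M[F]_(p, m)) (Y : 'M[F]_n) :
  Y *m (1%:M - (a + b *m K *m c)) = 1%:M ->
  (1%:M - (a + b *m K *m c)) *m Y = 1%:M ->
  let Phi := block_mx Y (Y *m b *m K)
               (K *m c *m Y) (K + K *m c *m Y *m b *m K) in
  row_mx (1%:M - a) (- b) *m Phi = row_mx 1%:M 0 /\
  Phi *m col_mx (1%:M - a) (- c) = col_mx 1%:M 0.
Proof.
move=> YN NY /=.
have aY : (1%:M - a) *m Y = 1%:M + b *m K *m c *m Y.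
  by rewrite -[X in _ = X + _]NY opprD addrA [in RHS]mulmxDl mulNmx addrNK.
have Ya : Y *m (1%:M - a) = 1%:M + Y *m b *m K *m c.
  rewrite -[X in _ = X + _]YN opprD addrA [in RHS]mulmxDr mulmxN.
  by rewrite !mulmxA addrNK.
split.
  rewrite mul_row_block !mulmxA aY !mulNmx; congr row_mx.
    by rewrite addrK.
  rewrite mulmxDl mulmxDl mul1mx mulmxDr !mulmxA.
  by rewrite subrr.
rewrite mul_block_col !mulmxN Ya; congr col_mx; first by rewrite addrK.
rewrite -[K *m c *m Y *m _]mulmxA Ya mulmxDr mulmx1 mulmxDl !mulmxA.
by rewrite opprD addrACA !subrr addr0.
Qed.

(** The right-hand constraints give K c = Ux Yx^-1 and the left-hand ones give
    b Ux = (1 - a) Yx - 1, whence b K = Yx^-1 Yy; both claims follow by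
    substitution. *)
Lemma controller_of_achievable (Yx : 'M[F]_n) (Yy : 'M[F]_(n, m))
    (Ux : 'M[F]_(p, n)) (Uy : 'M[F]_(p, m)) :
  row_mx (1%:M - a) (- b) *m block_mx Yx Yy Ux Uy = row_mx 1%:M 0 ->
  block_mx Yx Yy Ux Uy *m col_mx (1%:M - a) (- c) = col_mx 1%:M 0 ->
  Yx \in unitmx ->
  let K := Uy - Ux *m invmx Yx *m Yy in
  Yx *m (1%:M - (a + b *m K *m c)) = 1%:M /\ Yx *m b *m K = Yy.
Proof.
rewrite mul_row_block mul_block_col.
move=> /eq_row_mx[e1 e2] /eq_col_mx[e3 e4] uY /=.
set K := Uy - _.
have Kc : K *m c = Ux *m invmx Yx.
  rewrite mulmxBl -[_ *m Yy *m c]mulmxA.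
  have -> : Yy *m c = Yx *m (1%:M - a) - 1%:M.
    by rewrite -[X in _ = _ - X]e3 mulmxN opprD opprK addrA subrr add0r.
  have -> : Uy *m c = Ux *m (1%:M - a).
    by apply/eqP; rewrite -subr_eq0 -opprB oppr_eq0 -mulmxN e4.
  rewrite [X in _ - X]mulmxBr mulmx1 opprB addrCA.
  by rewrite -[Ux *m _ *m _]mulmxA mulKmx// subrr addr0.
have bU : b *m Ux = (1%:M - a) *m Yx - 1%:M.
  by rewrite -[X in _ = _ - X]e1 mulNmx opprD opprK addrA subrr add0r.
have bK : b *m K = invmx Yx *m Yy.
  rewrite mulmxBr !mulmxA bU.
  have -> : b *m Uy = (1%:M - a) *m Yy.
    by apply/eqP; rewrite -subr_eq0 -opprB oppr_eq0 -mulNmx e2.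
  rewrite -[X in _ - X]mulmxA [X in _ - X]mulmxBl mul1mx opprB addrCA.
  by rewrite -[_ *m (invmx _ *m _)]mulmxA mulKVmx// subrr addr0.
split; last by rewrite -mulmxA bK mulKVmx.
have : (1%:M - (a + b *m K *m c)) *m Yx = 1%:M.
  rewrite -[b *m K *m c]mulmxA Kc mulmxA bU opprD addrA mulmxBl mulmxKV//.
  by rewrite opprB addrCA subrr addr0.
exact: mulmx1C.
Qed.

End ResponseAlgebra.

(** * The switched closed loop *)

Section SwitchedLoop.
Context {R : realType} {T n p m M : nat}.
Variable A : 'I_M -> 'I_T.+1 -> 'M[R]_n.
Variable B : 'I_M -> 'I_T.+1 -> 'M[R]_(n, p).
Variable C : 'I_M -> 'I_T.+1 -> 'M[R]_(m, n).
Variable L : {set signal T M}.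
Variables wbar vbar : R.
Hypotheses (wbar_ge0 : 0 <= wbar) (vbar_ge0 : 0 <= vbar).

Local Notation same_prefix := Defs.same_prefix.
Local Notation Z := (downshift n).
Local Notation idx := {sigma : signal T M | sigma \in L}.
Local Notation controller := (controller (R := R) (T := T) (p := p) (m := m) L).
Local Notation responses := (responses R n p m L).
Local Notation admissible := (admissible R p m L).
Local Notation feasible_Phi := (feasible_Phi A B C L).
Implicit Types (s : signal T M) (i : idx) (t : 'I_T.+1).

Definition loop s (K : 'M[R]_(stack T p, stack T m)) : 'M[R]_(stack T n) :=
  Z *m bigA A s + Z *m bigB B s *m K *m bigC C s.

Lemma ZA_strict s : blk_strict (Z *m bigA A s).
Proof. exact: strictMl (downshift_strict _) (lower_blkdiag _). Qed.

Lemma ZB_strict s : blk_strict (Z *m bigB B s).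
Proof. exact: strictMl (downshift_strict _) (lower_blkdiag _). Qed.

Lemma loop_strict s K : blk_lower_trig K -> blk_strict (loop s K).
Proof.
move=> lK; apply: strictD; first exact: ZA_strict.
rewrite -mulmxA; apply: strictMl; first exact: ZB_strict.
by apply: lowerM => //; exact: lower_blkdiag.
Qed.

Lemma blk_lead_ZA t s s' : same_prefix t s s' ->
  blk_lead t (Z *m bigA A s) = blk_lead t (Z *m bigA A s').
Proof.
move=> ss'; apply: blk_leadM => //; try exact/strict_lower/downshift_strict.
by apply: blk_lead_blkdiag => j jt; rewrite ss'.
Qed.

Lemma blk_lead_ZB t s s' : same_prefix t s s' ->
  blk_lead t (Z *m bigB B s) = blk_lead t (Z *m bigB B s').
Proof.
move=> ss'; apply: blk_leadM => //; try exact/strict_lower/downshift_strict.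
by apply: blk_lead_blkdiag => j jt; rewrite ss'.
Qed.

Lemma blk_lead_C t s s' : same_prefix t s s' ->
  blk_lead t (bigC C s) = blk_lead t (bigC C s').
Proof. by move=> ss'; apply: blk_lead_blkdiag => j jt; rewrite ss'. Qed.

Lemma closed_loopP s K w v x u y : blk_lower_trig K ->
  closed_loop A B C s K w v x u y <->
  [/\ x = invmx (1%:M - loop s K) *m (w + Z *m bigB B s *m K *m v),
      y = bigC C s *m x + v & u = K *m y].
Proof.
move=> /(loop_strict s)/strict_unit uN; rewrite /closed_loop.
have loopE : Z *m (bigA A s *m x + bigB B s *m (K *m (bigC C s *m x + v))) + w
    = loop s K *m x + (w + Z *m bigB B s *m K *m v).
  rewrite /loop !mulmxDr mulmxDl !mulmxA -!addrA.
  by congr (_ + (_ + _)); rewrite addrC.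
split=> -[ex ey eu]; split=> //.
  move: ex; rewrite eu ey loopE => /eqP; rewrite addrC -subr_eq => /eqP <-.
  by rewrite -{2}[x]mul1mx -mulmxBl mulKmx.
rewrite eu ey loopE; apply/eqP; rewrite addrC -subr_eq; apply/eqP.
by rewrite -{1}[x]mul1mx -mulmxBl ex mulKVmx.
Qed.

Definition weighted (Phi : @response R T n p m) :=
  row_mx (Phi_xx Phi) (Phi_xy Phi) *m
    block_mx (wbar%:M : 'M[R]_(stack T n)) 0 0 (vbar%:M : 'M[R]_(stack T m)).

(** Only the state responses are prescribed: they alone enter the costs. *)
Definition realizes s (K : 'M[R]_(stack T p, stack T m))
    (Phi : @response R T n p m) :=
  Phi_xx Phi = invmx (1%:M - loop s K) /\
  Phi_xy Phi = Phi_xx Phi *m (Z *m bigB B s) *m K.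

(** A noise of norm at most wbar is wbar times a vector of the unit ball, also
    when wbar = 0, and likewise for vbar; so the admissible pairs of noises are
    the images of the unit ball under the weight matrix. *)
Lemma state_normsE s K Phi : blk_lower_trig K -> realizes s K Phi ->
  state_norms A B C wbar vbar s K =
    [set `|weighted Phi *m z| | z in
      [set z : 'cV[R]_(stack T n + stack T m) | `|z| <= 1]].
Proof.
move=> lK [exx exy].
have xE (z1 : 'cV_(stack T n)) (z2 : 'cV_(stack T m)) :
    weighted Phi *m col_mx z1 z2 = invmx (1%:M - loop s K) *m
      (wbar *: z1 + Z *m bigB B s *m K *m (vbar *: z2)).
  rewrite /weighted -mulmxA mul_block_col !mul0mx addr0 add0r mul_row_col.
  by rewrite exy exx !mul_scalar_mx mulmxDr !mulmxA.
apply/seteqP; split=> r /=.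
  move=> [w [v [x [u [y [/(scaled_ballP _ wbar_ge0)[z1 z11 ->]
    /(scaled_ballP _ vbar_ge0)[z2 z21 ->]
    /(closed_loopP _ _ _ _ _ _ lK)[ex _ _] ->]]]]]].
  by exists (col_mx z1 z2); [exact: col_mx_norm_le|rewrite xE ex].
move=> [z z1 <-]; rewrite -[z]vsubmxK.
set w := usubmx z; set v := dsubmx z; move: (xE w v) => {}xE.
have wv : `|w| <= 1 /\ `|v| <= 1.
  by move/(cV_norm_leP _ ler01) : z1 => z1; split; apply/cV_norm_leP => // j;
    rewrite mxE.
exists (wbar *: w), (vbar *: v), (weighted Phi *m col_mx w v).
exists (K *m (bigC C s *m (weighted Phi *m col_mx w v) + vbar *: v)).
exists (bigC C s *m (weighted Phi *m col_mx w v) + vbar *: v).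
split=> //; last exact/(closed_loopP _ _ _ _ _ _ lK).
  by apply/(scaled_ballP _ wbar_ge0); exists w => //; case: wv.
by apply/(scaled_ballP _ vbar_ge0); exists v => //; case: wv.
Qed.

(** The common core of both directions.  At least one signal is needed: the
    maximum over the empty language would be -oo in (P) and 0 in (P_Phi). *)
Lemma cost_P_Phi (K : controller) (Phi : responses) : (exists s, s \in L) ->
  (forall i, blk_lower_trig (K i)) ->
  (forall i, realizes (val i) (K i) (Phi i)) ->
  cost_P A B C L wbar vbar K = (cost_Phi L wbar vbar Phi)%:E.
Proof.
move=> [s0 s0L] lK KPhi; pose i0 : idx := Sub s0 s0L.
have supE i : ereal_sup [set r%:E | r in
    state_norms A B C wbar vbar (val i) (K i)] = (opnorm (weighted (Phi i)))%:E.
  rewrite (state_normsE (lK i) (KPhi i)) ereal_sup_EFin//.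
    exists (opnorm (weighted (Phi i))) => _ [z z1 <-]; exact: opnorm_ge.
  exists `|weighted (Phi i) *m (0 : 'cV_(stack T n + stack T m))|, 0 => //=.
  by rewrite normr0.
rewrite /cost_P (eq_bigr _ (fun i _ => supE i)).
have [k _ PhiE] : {k | k \in predT &
    cost_Phi L wbar vbar Phi = opnorm (weighted (Phi k))}.
  by apply: (eq_bigmax i0) => // i _; exact: opnorm_ge0.
apply/eqP; rewrite eq_le; apply/andP; split.
  apply: bigmax_le => [|i _]; first exact: leNye.
  by rewrite lee_fin; apply: (le_bigmax _ (fun i => opnorm (weighted (Phi i)))).
by rewrite PhiE; apply: (le_bigmax _ (fun i => (opnorm (weighted (Phi i)))%:E)).
Qed.

Definition response_of (K : controller) : responses :=
  [ffun i => let s := val i in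
    let Y := invmx (1%:M - loop s (K i)) in
    let b := Z *m bigB B s in
    let c := bigC C s in
    block_mx Y (Y *m b *m K i)
      (K i *m c *m Y) (K i + K i *m c *m Y *m b *m K i)].

Lemma realizes_response_of (K : controller) i :
  realizes (val i) (K i) (response_of K i).
Proof.
by rewrite /realizes ffunE /Phi_xx /Phi_xy block_mxKul block_mxKur.
Qed.

(** The blocks of the response are products and sums of Z B, C, K and
    (1 - N)^-1; all are block lower triangular, and their leading parts are
    determined by the signal prefix. *)
Lemma feasible_response_of (K : controller) :
  admissible K -> feasible_Phi (response_of K).
Proof.
move=> [lK pK].
have lB s : blk_lower_trig (Z *m bigB B s) by exact/strict_lower/ZB_strict.
have lC s : blk_lower_trig (bigC C s) by exact: lower_blkdiag.
have lY i : blk_lower_trig (invmx (1%:M - loop (val i) (K i))).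
  exact/lower_inv/loop_strict.
have lKC i : blk_lower_trig (K i *m bigC C (val i)) by exact: lowerM.
have lKCY i : blk_lower_trig
    (K i *m bigC C (val i) *m invmx (1%:M - loop (val i) (K i))).
  exact: lowerM.
have leadKC i j t : same_prefix t (val i) (val j) ->
    blk_lead t (K i *m bigC C (val i)) = blk_lead t (K j *m bigC C (val j)).
  by move=> ij; apply: blk_leadM => //; [exact: pK|exact: blk_lead_C].
have leadY i j t : same_prefix t (val i) (val j) ->
    blk_lead t (invmx (1%:M - loop (val i) (K i))) =
    blk_lead t (invmx (1%:M - loop (val j) (K j))).
  move=> ij; apply: blk_lead_inv; try exact: loop_strict.
  apply: blk_leadD; first exact: blk_lead_ZA.
  rewrite -[in LHS](mulmxA _ (K i)) -[in RHS](mulmxA _ (K j)).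
  by apply: blk_leadM => //; [exact: blk_lead_ZB|exact: leadKC].
have leadYB i j t : same_prefix t (val i) (val j) ->
    blk_lead t (invmx (1%:M - loop (val i) (K i)) *m (Z *m bigB B (val i))) =
    blk_lead t (invmx (1%:M - loop (val j) (K j)) *m (Z *m bigB B (val j))).
  by move=> ij; apply: blk_leadM => //; [exact: leadY|exact: blk_lead_ZB].
have leadKCY i j t : same_prefix t (val i) (val j) ->
    blk_lead t (K i *m bigC C (val i) *m invmx (1%:M - loop (val i) (K i))) =
    blk_lead t (K j *m bigC C (val j) *m invmx (1%:M - loop (val j) (K j))).
  by move=> ij; apply: blk_leadM => //; [exact: leadKC|exact: leadY].
split=> [i|i|]; rewrite /Phi_xx /Phi_xy /Phi_ux /Phi_uy.
- rewrite ffunE block_mxKul block_mxKur block_mxKdl block_mxKdr; split=> //.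
    by do 2!apply: lowerM => //.
  by apply: lowerD => //; do 2!apply: lowerM => //.
- have uN := strict_unit (loop_strict (val i) (lK i)).
  rewrite /achievable ffunE; apply: achievable_of_controller.
    exact: mulVmx.
  exact: mulmxV.
split=> i j t ij;
  rewrite !ffunE ?(block_mxKul, block_mxKur, block_mxKdl, block_mxKdr).
- exact: leadY.
- by apply: blk_leadM; [exact: lowerM|exact: lowerM|exact: leadYB|exact: pK].
- exact: leadKCY.
- apply: blk_leadD; first exact: pK.
  apply: blk_leadM; [| |apply: blk_leadM|exact: pK] => //.
  + by apply: lowerM.
  + by apply: lowerM.
  + exact: leadKCY.
  + exact: blk_lead_ZB.
Qed.

(** By the first constraint, Phi_xx is the identity plus a strictly block lower
    triangular matrix, hence invertible with an inverse that inherits its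
    block triangularity and its prefix constraint. *)
Section ControllerOf.
Variable Phi : responses.
Hypothesis fPhi : feasible_Phi Phi.

Let N i := Z *m bigA A (val i) *m Phi_xx (Phi i) +
  Z *m bigB B (val i) *m Phi_ux (Phi i).

Let N_strict i : blk_strict (N i).
Proof.
have [lPhi _ _] := fPhi; have [lxx _ lux _] := lPhi i.
by apply: strictD; apply: strictMl => //; [exact: ZA_strict|exact: ZB_strict].
Qed.

Let Phi_xxE i : Phi_xx (Phi i) = 1%:M - - N i.
Proof.
have [_ aPhi _] := fPhi; have [+ _] := aPhi i.
rewrite -{1}[Phi i]submxK mul_row_block => /eq_row_mx[e _].
rewrite opprK -[X in _ = X + _]e mulmxBl mul1mx mulNmx.
by rewrite -[_ - _ - _]addrA -opprD addrNK.
Qed.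

Lemma Phi_xx_unit i : Phi_xx (Phi i) \in unitmx.
Proof. by rewrite Phi_xxE strict_unit//; exact: strictN. Qed.

Lemma admissible_controller_of : admissible (controller_of Phi).
Proof.
have [lPhi _ [pxx pxy pux puy]] := fPhi.
have lI i : blk_lower_trig (invmx (Phi_xx (Phi i))).
  by rewrite Phi_xxE; exact/lower_inv/strictN.
split=> [i|i j t ij]; rewrite !ffunE.
  have [lxx lxy lux luy] := lPhi i.
  by apply: lowerD => //; apply: lowerN; do 2!apply: lowerM => //.
have [lxx lxy lux luy] := lPhi i; have [lxx' lxy' lux' luy'] := lPhi j.
apply: blk_leadD; first exact: puy.
apply: blk_leadN; apply: blk_leadM; try exact: lowerM; last exact: pxy.
apply: blk_leadM => //; first exact: pux.
rewrite !Phi_xxE; apply: blk_lead_inv; try exact: strictN.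
have := pxx i j t ij; rewrite !Phi_xxE !opprK => Nij.
apply: blk_leadN; rewrite -[N i](addKr 1%:M) -[N j](addKr 1%:M).
exact: blk_leadD.
Qed.

Lemma realizes_controller_of i : realizes (val i) (controller_of Phi i) (Phi i).
Proof.
have [_ aPhi _] := fPhi; have [] := aPhi i.
rewrite -{1 2}[Phi i]submxK => e1 e2.
have [YN YbK] := controller_of_achievable e1 e2 (Phi_xx_unit i).
rewrite /realizes ffunE; split; last by rewrite YbK.
have [_ uN] := mulmx1_unit YN.
by rewrite -[LHS](mulmxK uN) [X in X *m _]YN mul1mx.
Qed.

End ControllerOf.

(** * The convex program and the linear program *)

Lemma Phi_xx_linear i : linear (fun Phi : responses => Phi_xx (Phi i)).
Proof. by move=> u x y; apply/matrixP => r c; rewrite !mxE !ffunE !mxE. Qed.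

Lemma Phi_xy_linear i : linear (fun Phi : responses => Phi_xy (Phi i)).
Proof. by move=> u x y; apply/matrixP => r c; rewrite !mxE !ffunE !mxE. Qed.

Lemma Phi_ux_linear i : linear (fun Phi : responses => Phi_ux (Phi i)).
Proof. by move=> u x y; apply/matrixP => r c; rewrite !mxE !ffunE !mxE. Qed.

Lemma Phi_uy_linear i : linear (fun Phi : responses => Phi_uy (Phi i)).
Proof. by move=> u x y; apply/matrixP => r c; rewrite !mxE !ffunE !mxE. Qed.

Lemma lower_linear_equations (E : lmodType R) a b
    (f : E -> 'M[R]_(stack T a, stack T b)) : linear f ->
  linear_equations [set z | blk_lower_trig (f z)].
Proof.
move=> lf; apply: linear_system_forall => i; apply: linear_system_forall => j.
apply: linear_system_imply; apply: linear_equations_mx => u x y.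
by rewrite lf blkD blkZ.
Qed.

Lemma prefix_linear_equations (E : lmodType R) a b
    (f : E -> idx -> 'M[R]_(stack T a, stack T b)) :
  (forall i, linear (f^~ i)) ->
  linear_equations [set z | prefix_constraint (f z)].
Proof.
move=> lf; apply: linear_system_forall => i; apply: linear_system_forall => j.
apply: linear_system_forall => t; apply: linear_system_imply.
rewrite [X in linear_system _ X](_ : _ = [set z |
    forall k l : 'I_T.+1, (k <= t)%N -> (l <= t)%N ->
    blk (f z i) k l - blk (f z j) k l = 0]).
  apply: linear_system_forall => k; apply: linear_system_forall => l.
  do 2!apply: linear_system_imply; apply: linear_equations_mx => u x y.
  by rewrite !lf !blkD !blkZ scalerBr opprD addrACA.
apply/seteqP; split=> z /=.
  by move=> /blk_leadP eqf k l kt lt; rewrite eqf// subrr.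
by move=> eqf; apply/blk_leadP => k l kt lt; apply/subr0_eq/eqf.
Qed.

Lemma achievable_linear_equations i :
  linear_equations [set Phi : responses | achievable A B C (val i) (Phi i)].
Proof.
apply: linear_systemI; apply: linear_equations_mx => u x y; rewrite !ffunE.
  by rewrite mulmxDr -scalemxAr.
by rewrite mulmxDl -scalemxAl.
Qed.

Lemma feasible_linear_equations : linear_equations feasible_Phi.
Proof.
rewrite (_ : feasible_Phi =
  [set Phi | forall i, blk_lower_trig (Phi_xx (Phi i))] `&`
  [set Phi | forall i, blk_lower_trig (Phi_xy (Phi i))] `&`
  [set Phi | forall i, blk_lower_trig (Phi_ux (Phi i))] `&`
  [set Phi | forall i, blk_lower_trig (Phi_uy (Phi i))] `&`
  [set Phi | forall i, achievable A B C (val i) (Phi i)] `&`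
  [set Phi | prefix_constraint (fun i => Phi_xx (Phi i))] `&`
  [set Phi | prefix_constraint (fun i => Phi_xy (Phi i))] `&`
  [set Phi | prefix_constraint (fun i => Phi_ux (Phi i))] `&`
  [set Phi | prefix_constraint (fun i => Phi_uy (Phi i))]).
  do 8?apply: linear_systemI.
  - apply: linear_system_forall => i.
    exact/lower_linear_equations/Phi_xx_linear.
  - apply: linear_system_forall => i.
    exact/lower_linear_equations/Phi_xy_linear.
  - apply: linear_system_forall => i.
    exact/lower_linear_equations/Phi_ux_linear.
  - apply: linear_system_forall => i.
    exact/lower_linear_equations/Phi_uy_linear.
  - by apply: linear_system_forall => i; exact: achievable_linear_equations.
  - apply: (prefix_linear_equations
      (f := fun (Phi : responses) i => Phi_xx (Phi i))).
    exact: Phi_xx_linear.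
  - apply: (prefix_linear_equations
      (f := fun (Phi : responses) i => Phi_xy (Phi i))).
    exact: Phi_xy_linear.
  - apply: (prefix_linear_equations
      (f := fun (Phi : responses) i => Phi_ux (Phi i))).
    exact: Phi_ux_linear.
  - apply: (prefix_linear_equations
      (f := fun (Phi : responses) i => Phi_uy (Phi i))).
    exact: Phi_uy_linear.
apply/seteqP; split=> Phi.
  move=> [lPhi aPhi [pxx pxy pux puy]].
  by do !split=> //; move=> i; case: (lPhi i).
by move=> [[[[[[[[lxx lxy] lux] luy] aPhi] pxx] pxy] pux] puy].
Qed.

Definition weighted_entry (k : idx * 'I_(stack T n)) j (Phi : responses) :=
  weighted (Phi k.1) k.2 j.

Lemma weighted_entry_linear k j :
  linear (weighted_entry k j : responses -> R^o).
Proof.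
move=> u x y; rewrite /weighted_entry /weighted Phi_xx_linear Phi_xy_linear.
by rewrite -add_row_mx -scale_row_mx mulmxDl -scalemxAl !mxE.
Qed.

Lemma cost_PhiE (Phi : responses) : cost_Phi L wbar vbar Phi =
  \big[Num.max/0]_k \sum_j `|weighted_entry k j Phi|.
Proof.
rewrite /cost_Phi; apply/eqP; rewrite eq_le; apply/andP; split.
  apply: bigmax_le => [|i _]; first exact: bigmax_ge_id.
  rewrite opnormE; apply: bigmax_le => [|r _]; first exact: bigmax_ge_id.
  exact: (le_bigmax _ (fun k => \sum_j `|weighted_entry k j Phi|) (i, r)).
apply: bigmax_le => [|[i r] _]; first exact: bigmax_ge_id.
apply: le_trans (le_bigmax _ (fun i => opnorm (weighted (Phi i))) i).
rewrite opnormE; exact: (le_bigmax _ (fun r => \sum_j `|weighted (Phi i) r j|)).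
Qed.

End SwitchedLoop.

Theorem mainTheorem3 (R : realType) (T n p m M : nat)
    (A : 'I_M -> 'I_T.+1 -> 'M[R]_n)
    (B : 'I_M -> 'I_T.+1 -> 'M[R]_(n, p))
    (C : 'I_M -> 'I_T.+1 -> 'M[R]_(m, n))
    (L : {set signal T M}) (L_neq0 : exists sigma, sigma \in L)
    (wbar vbar : R) (wbar_ge0 : 0 <= wbar) (vbar_ge0 : 0 <= vbar) :
  (* (P) is well posed: the closed-loop trajectory exists and is unique, and
     the maxima over the noises are attained *)
  (forall K, admissible R p m L K -> forall i,
     (forall w v, exists! xuy, let: (x, u, y) := xuy in
        closed_loop A B C (val i) (K i) w v x u y) /\
     (exists2 r, state_norms A B C wbar vbar (val i) (K i) r &
        forall s, state_norms A B C wbar vbar (val i) (K i) s -> s <= r)) /\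
  (* (P) and (P_Phi) have the same optimal value *)
  optimal_value (admissible R p m L) (cost_P A B C L wbar vbar) =
    optimal_value (feasible_Phi A B C L) (EFin \o cost_Phi L wbar vbar) /\
  (* optimal responses yield optimal controllers *)
  (forall Phi : responses R n p m L,
     optimal (feasible_Phi A B C L) (EFin \o cost_Phi L wbar vbar) Phi ->
     (forall i, Phi_xx (Phi i) \in unitmx) /\
     optimal (admissible R p m L) (cost_P A B C L wbar vbar)
       (controller_of Phi)) /\
  (* (P_Phi) is a convex program *)
  convex_function setT (cost_Phi L wbar vbar : responses R n p m L -> R) /\
  affine_constraints (feasible_Phi A B C L) /\
  (* (P_Phi) can be written as a linear program with auxiliary variables *)
  exists (a : nat) (P : linear_program (responses R n p m L * 'cV[R]_a)%type),
    lp_reformulation (feasible_Phi A B C L) (cost_Phi L wbar vbar) P.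
Proof.
have Kok K : admissible R p m L K ->
    feasible_Phi A B C L (response_of A B C K) /\
    cost_P A B C L wbar vbar K =
      (cost_Phi L wbar vbar (response_of A B C K))%:E.
  move=> aK; split; first exact: feasible_response_of.
  apply: cost_P_Phi => //; first by case: aK.
  by move=> i; exact: realizes_response_of.
have Phiok Phi : feasible_Phi A B C L Phi ->
    admissible R p m L (controller_of Phi) /\
    cost_P A B C L wbar vbar (controller_of Phi) =
      (cost_Phi L wbar vbar Phi)%:E.
  move=> fPhi; have aK := admissible_controller_of fPhi.
  split=> //; apply: cost_P_Phi => //; first by case: aK.
  by move=> i; exact: realizes_controller_of.
have costE := funext (@cost_PhiE R T n p m M L wbar vbar).
split; [|split; [|split; [|split; [|split]]]].
- move=> K [lK pK] i; split=> [w v|].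
    pose x := invmx (1%:M - loop A B C (val i) (K i)) *m
      (w + downshift n *m bigB B (val i) *m K i *m v).
    pose y := bigC C (val i) *m x + v.
    exists (x, K i *m y, y); split; first exact/closed_loopP.
    by move=> [[x' u'] y'] /closed_loopP[//|ex ey eu]; rewrite eu ey ex.
  have KPhi := realizes_response_of A B C K i.
  rewrite (state_normsE wbar_ge0 vbar_ge0 (lK i) KPhi).
  have [z z1 zE] :=
    opnorm_attained (weighted wbar vbar (response_of A B C K i)).
  exists (opnorm (weighted wbar vbar (response_of A B C K i))).
    by exists z.
  by move=> _ [z' z'1 <-]; exact: opnorm_ge.
- congr ereal_inf; apply/seteqP; split=> c /=.
    by move=> [K /Kok[fPhi ->] <-]; exists (response_of A B C K).
  by move=> [Phi /Phiok[aK KE] <-]; exists (controller_of Phi).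
- move=> Phi [fPhi optPhi]; split; first exact: Phi_xx_unit fPhi.
  have [aK KE] := Phiok _ fPhi; split=> // K /Kok[fK ->].
  by rewrite KE; exact: optPhi.
- rewrite costE.
  exact/max_row_sum_convex/weighted_entry_linear.
- exact/affine_linear_equations/feasible_linear_equations.
- rewrite costE.
  apply: max_row_sum_lp; first exact: weighted_entry_linear.
  exact: feasible_linear_equations.
Qed.
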